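(* Let $\Gamma,\Delta$ be sets, let $W=\mathrm{Sym}(\Gamma)\wr\mathrm{Sym}(\Delta)$ act in product action on $\Pi=\mathrm{Func}(\Delta,\Gamma)$, and let $B=\mathrm{Func}(\Delta,\mathrm{Sym}(\Gamma))$ be the base group of $W$. Let $X\leq W$ be a subgroup, let $\varphi\in\mathrm{Func}(\Delta,\Gamma)$ and let $\delta_1\in\Delta$. Then the following hold. (a) There is an element $x\in B$ such that the components of $x^{-1}Xx$ are constant on each $X$-orbit in $\Delta$; that is, whenever $\delta,\delta'\in\Delta$ lie in the same $X$-orbit under the induced action of $X$ on $\Delta$, the $\delta$-component and the $\delta'$-component of $x^{-1}Xx$ are the same subgroup of $\mathrm{Sym}(\Gamma)$. Moreover, if the $\delta$-component of $X$ is transitive on $\Gamma$ for each $\delta\in\Delta$, then $x$ can be chosen so that in addition $\varphi x=\varphi$. (b) If the group $H\leq\mathrm{Sym}(\Delta)$ induced by $X$ on $\Delta$ is transitive on $\Delta$, and if $G\leq \mathrm{Sym}(\Gamma)$ is the $\delta_1$-component of $X$, then the element $x$ in (a) may be chosen in $B=\mathrm{Func}(\Delta,\mathrm{Sym}(\Gamma))$ such that $x^{-1}Xx\leq G\wr H$ (and also such that $\varphi x=\varphi$ if $G$ is transitive on $\Gamma$).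
   Context: All actions are on the right: the image of $\delta$ under a map $f$ is written $\delta f$, and products are composed left to right. The sets $\Gamma,\Delta$ may be infinite. $\mathrm{Func}(A,C)$ denotes the set of all functions from $A$ to $C$. Wreath product. For $G\leq\mathrm{Sym}(\Gamma)$ and $H\leq\mathrm{Sym}(\Delta)$, $\mathrm{Func}(\Delta,G)$ is a group under pointwise multiplication, $\delta(fg)=(\delta f)(\delta g)$. The group $H$ acts on it by $\delta f^{h}=(\delta h^{-1})f$, and $G\wr H$ is the semidirect product $\mathrm{Func}(\Delta,G)\rtimes H$. Its elements are written uniquely as $fh$ with $f\in\mathrm{Func}(\Delta,G)$, $h\in H$, and $h^{-1}fh=f^h$. The full wreath product $W=\mathrm{Sym}(\Gamma)\wr\mathrm{Sym}(\Delta)$ has base group $B=\mathrm{Func}(\Delta,\mathrm{Sym}(\Gamma))$, and $G\wr H$ is regarded as the particular subgroup $\{fh : f\in B,\ \delta f\in G\text{ for all }\delta\in\Delta,\ h\in H\}$ of $W$ (not merely an isomorphism type). Product action. For $\varphi\in\Pi=\mathrm{Func}(\Delta,\Gamma)$ and $g=fh\in W$, the function $\varphi g\in\Pi$ is given by $\delta(\varphi g)=\big((\delta h^{-1})\varphi\big)\big((\delta h^{-1})f\big)$ for all $\delta\in\Delta$. Induced action and components. Let $X\leq W$. The induced action of $X$ on $\Delta$ is $fh:\delta\mapsto\delta h$; the group induced by $X$ on $\Delta$ is $\{h : fh\in X \text{ for some } f\in B\}\leq\mathrm{Sym}(\Delta)$. For $\delta\in\Delta$, the $\delta$-component of $X$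 is the subgroup $\{\delta f : fh\in X,\ f\in B,\ h\in\mathrm{Sym}(\Delta),\ \delta h=\delta\}$ of $\mathrm{Sym}(\Gamma)$. *)

(* Defs.v *)
From HB Require Import structures.
From mathcomp Require Import all_boot.
From mathcomp Require Import boolp classical_sets.

Set Implicit Arguments.
Unset Strict Implicit.
Unset Printing Implicit Defensive.

Local Open Scope classical_set_scope.
Local Open Scope group_scope.

(* {sym T} is the full symmetric group of a possibly infinite set T. All
   actions are on the right: the image of a under g, written ag on paper, is
   the Rocq application [g a], and [g * h] maps a to h (g a). *)
Record sym (T : Type) := Sym {
  sym_fun :> T -> T;
  sym_finv : T -> T;
  sym_funK : cancel sym_fun sym_finv;
  sym_finvK : cancel sym_finv sym_fun
}.

Notation "{ 'sym' T }" := (sym T) (at level 0, format "{ 'sym'  T }") : type_scope.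

Section SymGroup.
Variable T : Type.
Implicit Types g h : {sym T}.

Lemma symP g h : g =1 h -> g = h.
Proof.
case: g h => [f f' fK f'K] [k k' kK k'K] /= /funext e; subst k.
have e : f' = k' by apply/funext => x; rewrite -{1}(k'K x) fK.
by subst k'; congr Sym; exact: Prop_irrelevance.
Qed.

HB.instance Definition _ := gen_eqMixin {sym T}.
HB.instance Definition _ := gen_choiceMixin {sym T}.

Definition sym_one : {sym T} := @Sym T id id (fun=> erefl) (fun=> erefl).
Definition sym_inv g : {sym T} := Sym (@sym_finvK T g) (@sym_funK T g).
Definition sym_mul g h : {sym T} :=
  Sym (can_comp (@sym_funK T h) (@sym_funK T g))
      (can_comp (@sym_finvK T g) (@sym_finvK T h)).

Lemma sym_mulA : associative sym_mul. Proof. by move=> g h k; apply: symP. Qed.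
Lemma sym_mul1g : left_id sym_one sym_mul. Proof. by move=> g; apply: symP. Qed.
Lemma sym_mulg1 : right_id sym_one sym_mul. Proof. by move=> g; apply: symP. Qed.
Lemma sym_mulVg : left_inverse sym_one sym_inv sym_mul.
Proof. by move=> g; apply: symP => x /=; exact: sym_finvK. Qed.
Lemma sym_mulgV : right_inverse sym_one sym_inv sym_mul.
Proof. by move=> g; apply: symP => x /=; exact: sym_funK. Qed.

HB.instance Definition _ :=
  isGroup.Build {sym T} sym_mulA sym_mul1g sym_mulg1 sym_mulVg sym_mulgV.

Lemma sym1E x : (1 : {sym T}) x = x. Proof. by []. Qed.
Lemma symME g h x : (g * h) x = h (g x). Proof. by []. Qed.
Lemma symKV g x : g (g^-1 x) = x. Proof. exact: sym_finvK. Qed.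
Lemma symVK g x : g^-1 (g x) = x. Proof. exact: sym_funK. Qed.

End SymGroup.

Section PermutationSets.
Variable T : Type.

Definition perm_orbit (A : set {sym T}) (a : T) : set T := [set g a | g in A].

Definition perm_transitive (A : set {sym T}) : Prop :=
  forall a, perm_orbit A a = [set: T].

End PermutationSets.

(* The base group B of the full wreath product, with its pointwise product. *)
Definition base (Gamma Delta : Type) : Type := Delta -> {sym Gamma}.

Section BaseGroup.
Variables Gamma Delta : Type.
Implicit Types f g : base Gamma Delta.

HB.instance Definition _ := gen_eqMixin (base Gamma Delta).
HB.instance Definition _ := gen_choiceMixin (base Gamma Delta).

Definition base_one : base Gamma Delta := fun=> 1.
Definition base_inv f : base Gamma Delta := fun d => (f d)^-1.
Definition base_mul f g : base Gamma Delta := fun d => f d * g d.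

Lemma base_mulA : associative base_mul.
Proof. by move=> f g k; apply/funext => d; exact: mulgA. Qed.
Lemma base_mul1g : left_id base_one base_mul.
Proof. by move=> f; apply/funext => d; exact: mul1g. Qed.
Lemma base_mulg1 : right_id base_one base_mul.
Proof. by move=> f; apply/funext => d; exact: mulg1. Qed.
Lemma base_mulVg : left_inverse base_one base_inv base_mul.
Proof. by move=> f; apply/funext => d; exact: mulVg. Qed.
Lemma base_mulgV : right_inverse base_one base_inv base_mul.
Proof. by move=> f; apply/funext => d; exact: mulgV. Qed.

HB.instance Definition _ := isGroup.Build (base Gamma Delta)
  base_mulA base_mul1g base_mulg1 base_mulVg base_mulgV.

Definition base_act f (h : {sym Delta}) : base Gamma Delta :=
  fun d => f (h^-1 d).

Lemma base_act1 f : base_act f 1 = f. Proof. by []. Qed.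
Lemma base_actM f h k : base_act f (h * k) = base_act (base_act f h) k.
Proof. by []. Qed.
Lemma base_actMl f g h : base_act (f * g) h = base_act f h * base_act g h.
Proof. by []. Qed.

End BaseGroup.

(* [Wreath f h] is the element fh of the full wreath product W. *)
Record wreath (Gamma Delta : Type) := Wreath {
  wbase : base Gamma Delta;
  wtop : {sym Delta}
}.

Section WreathGroup.
Variables Gamma Delta : Type.
Local Notation W := (wreath Gamma Delta).
Implicit Types u v w : W.

HB.instance Definition _ := gen_eqMixin W.
HB.instance Definition _ := gen_choiceMixin W.

(* (f h) (f' h') = f (h f' h^-1) h h', where h f' h^-1 is the image of f'
   under h^-1. *)
Definition wreath_mul u v : W :=
  Wreath (wbase u * base_act (wbase v) (wtop u)^-1) (wtop u * wtop v).
Definition wreath_one : W := Wreath 1 1.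
Definition wreath_inv u : W :=
  Wreath (base_act (wbase u)^-1 (wtop u)) (wtop u)^-1.

Lemma wreath_mulA : associative wreath_mul.
Proof.
by move=> u v w; rewrite /wreath_mul /= base_actMl !mulgA invgM base_actM.
Qed.
Lemma wreath_mul1g : left_id wreath_one wreath_mul.
Proof. by case=> f h; rewrite /wreath_mul /= invg1 base_act1 !mul1g. Qed.
Lemma wreath_mulg1 : right_id wreath_one wreath_mul.
Proof. by case=> f h; rewrite /wreath_mul /= !mulg1; congr Wreath; exact: mulg1. Qed.
Lemma wreath_mulVg : left_inverse wreath_one wreath_inv wreath_mul.
Proof.
by case=> f h; rewrite /wreath_mul /= invgK -base_actMl mulVg mulVg.
Qed.
Lemma wreath_mulgV : right_inverse wreath_one wreath_inv wreath_mul.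
Proof.
by case=> f h; rewrite /wreath_mul /= -base_actM mulgV base_act1 mulgV.
Qed.

HB.instance Definition _ := isGroup.Build W
  wreath_mulA wreath_mul1g wreath_mulg1 wreath_mulVg wreath_mulgV.

Definition in_base (f : base Gamma Delta) : W := Wreath f 1.
Definition in_top (h : {sym Delta}) : W := Wreath 1 h.

Lemma wreathE f h : in_base f * in_top h = Wreath f h.
Proof. by congr Wreath; [exact: mulg1 | exact: mul1g]. Qed.

Lemma conj_in_base f h : in_base f ^ in_top h = in_base (base_act f h).
Proof.
rewrite /conjg wreathE; congr Wreath; last exact: mulVg.
by rewrite /= invgK; exact: mul1g.
Qed.

(* G wr H as the actual subset of W; it is a subgroup when G and H are. *)
Definition wreath_sub (G : set {sym Gamma}) (H : set {sym Delta}) : set W :=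
  [set w | (forall d, G (wbase w d)) /\ H (wtop w)].

Definition product_act (phi : Delta -> Gamma) (w : W) : Delta -> Gamma :=
  fun d => wbase w ((wtop w)^-1 d) (phi ((wtop w)^-1 d)).

Lemma product_act1 phi : product_act phi 1 = phi. Proof. by []. Qed.
Lemma product_actM phi u v :
  product_act phi (u * v) = product_act (product_act phi u) v.
Proof.
apply/funext => d; rewrite /product_act.
have -> : wtop (u * v) = wtop u * wtop v by [].
have -> : wbase (u * v) = wbase u * base_act (wbase v) (wtop u)^-1 by [].
by rewrite invgM symME symME /base_act invgK symKV.
Qed.

Definition induced_group (X : set W) : set {sym Delta} :=
  [set wtop w | w in X].

Definition component (X : set W) (d : Delta) : set {sym Gamma} :=
  [set wbase w d | w in [set w | X w /\ wtop w d = d]].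

Definition conj_set (X : set W) (x : W) : set W := [set w ^ x | w in X].

Definition components_constant_on_orbits (X Y : set W) : Prop :=
  forall d d', perm_orbit (induced_group X) d d' ->
    component Y d = component Y d'.

End WreathGroup.

(* Main.v *)
Require Import Defs.
From HB Require Import structures.
From mathcomp Require Import all_boot.
From mathcomp Require Import boolp classical_sets.

(** Conjugation by an element of the base group leaves the action on Delta
    alone and only changes the coordinates on the copies of Gamma: if w = fh
    and x lies in B, then w^x has base part d |-> (x d)^-1 (f d) (x (d h)).
    The proof identifies all copies of Gamma belonging to one X-orbit with the
    copy at a representative of that orbit, using elements of X.

    Let r d be a representative of the orbit of d, and let t_d in X have top
    part taking r d to d and base part a_d at r d. Put x d = a_d^-1. For
    w = fh in X, the entry of w^x at d is a_d (f d) (a_(d h))^-1, which is the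
    entry at r d of the element t_d w t_(d h)^-1 of X. Since d and d h have the
    same representative, this element fixes r d, so the entry lies in the
    component of X at r d. Conversely, an element s of X fixing r d yields
    w = t_d^-1 s t_d, whose conjugate by x has at d the entry of s at r d.
    Hence the d-component of X^x is the (r d)-component of X, which depends only
    on the orbit of d ([exists_straightening]).

    The requirement that x fix phi says that every a_d fixes phi d. If the
    component at r d is transitive, an arbitrary t_d can be corrected by an
    element of X fixing r d so that this holds ([exists_transporter]).

    Part (a) takes any choice of one point in each orbit as r; part (b), where
    Delta is a single orbit, takes r constantly equal to delta1, and then the
    entries of X^x lie in the component G at delta1. *)

Local Open Scope classical_set_scope.
Local Open Scope group_scope.

Section Straightening.
Variables Gamma Delta : Type.
Local Notation W := (wreath Gamma Delta).
Variable X : set W.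
Hypothesis X_group : group_closed (mem X).

Lemma group_set1 : X 1.
Proof. by case: X_group => + _; rewrite inE. Qed.

Lemma group_setV u : X u -> X u^-1.
Proof. by have := @group_closedV _ _ X_group u; rewrite !inE. Qed.

Lemma group_setM u v : X u -> X v -> X (u * v).
Proof. by have := @group_closedM _ _ X_group u v; rewrite !inE. Qed.

Lemma wtopM (u v : W) d : wtop (u * v) d = wtop v (wtop u d).
Proof. by []. Qed.

Lemma wbaseM (u v : W) d : wbase (u * v) d = wbase u d * wbase v (wtop u d).
Proof. by case: u v => [f h] [k l]; rewrite /= /base_act invgK. Qed.

Lemma wtopV (u : W) d d' : wtop u d = d' -> wtop u^-1 d' = d.
Proof. by move=> <-; exact: symVK. Qed.

Lemma wbaseV (u : W) d d' : wtop u d = d' -> wbase u^-1 d' = (wbase u d)^-1.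
Proof.
move=> ud; apply: (mulgI (wbase u d)).
by rewrite mulgV -ud -wbaseM mulgV.
Qed.

Lemma wtop_conj_base (w : W) x : wtop (w ^ in_base x) = wtop w.
Proof. by apply: symP. Qed.

Lemma wbase_conj_base (w : W) x d :
  wbase (w ^ in_base x) d = (x d)^-1 * wbase w d * x (wtop w d).
Proof. by rewrite /conjg !wbaseM (@wbaseV (in_base x) d) // mulgA. Qed.

Lemma orbit_refl d : perm_orbit (induced_group X) d d.
Proof. by exists 1 => //; exists 1 => //; exact: group_set1. Qed.

Lemma orbit_sym d d' : perm_orbit (induced_group X) d d' ->
  perm_orbit (induced_group X) d' d.
Proof.
case=> _ [u Xu <-] ud; exists (wtop u^-1); last exact: wtopV.
by exists u^-1 => //; exact: group_setV.
Qed.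

Lemma orbit_trans d d' d'' : perm_orbit (induced_group X) d d' ->
  perm_orbit (induced_group X) d' d'' -> perm_orbit (induced_group X) d d''.
Proof.
case=> _ [u Xu <-] <- [_ [v Xv <-] <-]; exists (wtop (u * v)) => //.
by exists (u * v) => //; exact: group_setM.
Qed.

(** If u in X takes e to d, then so does s u for every s in X fixing e, and
    its entry at e is that of s followed by that of u. A transitive component
    offers an s whose entry takes a to the preimage of a under that of u. *)
Lemma exists_transporter e d (a : Gamma) :
  perm_orbit (induced_group X) e d ->
  exists t : W, [/\ X t, wtop t e = d &
    perm_transitive (component X e) -> wbase t e a = a].
Proof.
case=> _ [u Xu <-] ue.
have [tr|ntr] := pselect (perm_transitive (component X e)); last by exists u.
have : perm_orbit (component X e) a ((wbase u e)^-1 a) by rewrite tr.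
case=> _ [s [Xs se] <-] sa; exists (s * u); split.
- exact: group_setM.
- by rewrite wtopM se.
- by move=> _; rewrite wbaseM se symME sa symKV.
Qed.

(** A function r with these two properties picks one point in each orbit. *)
Lemma exists_orbit_representative (d0 : Delta) :
  exists r : Delta -> Delta,
    (forall d, perm_orbit (induced_group X) (r d) d) /\
    (forall d d', perm_orbit (induced_group X) d d' -> r d = r d').
Proof.
(* Choosing from the orbit as a set makes the representative independent of
   the point of the orbit. *)
have /choice[c cP] : forall A : set Delta, exists d, A !=set0 -> A d.
  move=> A; have [[d Ad]|nA] := pselect (A !=set0); first by exists d.
  by exists d0.
exists (fun d => c (perm_orbit (induced_group X) d)); split=> [d|d d' dd'].
  by apply: orbit_sym; apply: cP; exists d; exact: orbit_refl.
congr c; apply/seteqP; split=> e; apply: orbit_trans => //.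
exact: orbit_sym.
Qed.

(** Conjugating by the inverses of the entries of transporters from r d to d
    moves every entry of X into the component at the representative. The system
    of representatives is left free so that in the transitive case it can be
    a single prescribed point. *)
Lemma exists_straightening (r : Delta -> Delta) (phi : Delta -> Gamma) :
  (forall d, perm_orbit (induced_group X) (r d) d) ->
  (forall d d', perm_orbit (induced_group X) d d' -> r d = r d') ->
  exists x : base Gamma Delta,
    [/\ forall w d, X w -> component X (r d) (wbase (w ^ in_base x) d),
        forall d, component (conj_set X (in_base x)) d = component X (r d) &
        (forall d, perm_transitive (component X (r d))) ->
        product_act phi (in_base x) = phi].
Proof.
move=> r_orbit r_const.
have /choice[t tP] := fun d => exists_transporter _ d (phi d) (r_orbit d).
pose x : base Gamma Delta := fun d => (wbase (t d) (r d))^-1.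
have entry w d : X w -> component X (r d) (wbase (w ^ in_base x) d).
  move=> Xw; have [Xt td _] := tP d; have [Xt' td' _] := tP (wtop w d).
  have rw : r (wtop w d) = r d.
    by apply/esym/r_const; exists (wtop w) => //; exists w.
  exists (t d * w * (t (wtop w d))^-1).
    split; last by rewrite !wtopM td -rw; exact: wtopV.
    by do 2?apply: group_setM => //; exact: group_setV.
  by rewrite wbase_conj_base !wbaseM wtopM td (wbaseV _ _ _ td') /x invgK rw.
exists x; split=> // [d|tr].
  apply/seteqP; split=> [_ [_ [[w Xw <-] _] <-]|_ [s [Xs sr] <-]].
    exact: entry.
  have [Xt td _] := tP d.
  have wd : wtop ((t d)^-1 * s * t d) d = d.
    by rewrite !wtopM (wtopV _ _ _ td) sr.
  exists (((t d)^-1 * s * t d) ^ in_base x).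
    split; last by rewrite wtop_conj_base.
    exists ((t d)^-1 * s * t d) => //.
    by do 2?apply: group_setM => //; exact: group_setV.
  rewrite wbase_conj_base wd !wbaseM wtopM (wtopV _ _ _ td) sr.
  rewrite (wbaseV _ _ _ td) /x invgK.
  by rewrite !mulgA mulgV mul1g -mulgA mulgV mulg1.
apply/funext => d; have [_ _ /(_ (tr d)) fix_phi] := tP d.
by change (x d (phi d) = phi d); rewrite /x -{1}fix_phi symVK.
Qed.

End Straightening.

Theorem theorem1p1 (Gamma Delta : Type) (X : set (wreath Gamma Delta))
    (phi : Delta -> Gamma) (delta1 : Delta)
    (X_group : group_closed (mem X)) :
  (* (a) *)
  ((exists x : base Gamma Delta,
      components_constant_on_orbits X (conj_set X (in_base x)))
   /\
   ((forall delta : Delta, perm_transitive (component X delta)) ->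
    exists x : base Gamma Delta,
      components_constant_on_orbits X (conj_set X (in_base x)) /\
      product_act phi (in_base x) = phi))
  /\
  (* (b) *)
  (forall (H : set {sym Delta}) (G : set {sym Gamma}),
    H = induced_group X -> perm_transitive H -> G = component X delta1 ->
    (exists x : base Gamma Delta,
       components_constant_on_orbits X (conj_set X (in_base x)) /\
       conj_set X (in_base x) `<=` wreath_sub G H)
    /\
    (perm_transitive G ->
     exists x : base Gamma Delta,
       [/\ components_constant_on_orbits X (conj_set X (in_base x)),
           conj_set X (in_base x) `<=` wreath_sub G H &
           product_act phi (in_base x) = phi])).
Proof.
split.
  have [r [r_orbit r_const]] := exists_orbit_representative _ _ X X_group delta1.
  have [x [_ comp fix_phi]] :=
    exists_straightening _ _ X X_group r phi r_orbit r_const.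
  have cst : components_constant_on_orbits X (conj_set X (in_base x)).
    by move=> d d' /r_const rdd'; rewrite !comp rdd'.
  by split=> [|tr]; exists x => //; split=> //; apply: fix_phi.
move=> H G -> trH ->.
have to_delta1 d : perm_orbit (induced_group X) delta1 d by rewrite trH.
have [x [entry comp fix_phi]] :=
  exists_straightening _ _ X X_group (fun=> delta1) phi to_delta1
    (fun _ _ _ => erefl).
have cst : components_constant_on_orbits X (conj_set X (in_base x)).
  by move=> d d' _; rewrite !comp.
have sub : conj_set X (in_base x) `<=`
    wreath_sub (component X delta1) (induced_group X).
  move=> _ [w Xw <-]; split=> [d|]; first exact: entry.
  by exists w => //; rewrite wtop_conj_base.
by split=> [|tr]; exists x; split=> //; apply: fix_phi.
Qed.
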